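(* There exists a nontrivial upcycle for $\{0,1\}^8$.
   Context: Let $A$ be an alphabet (a finite set of letters) with $a=|A|\ge 2$, and let $\diamond\notin A$ be a wildcard symbol (''diamond''). A word over $A$ is a finite sequence of letters; a partial word is a finite sequence over $A\cup\{\diamond\}$; a cyclic partial word $(u_1\cdots u_N)$ is a cyclically ordered sequence over $A\cup\{\diamond\}$, with indices taken modulo $N$. A partial word $x$ covers a partial word $y$ of the same length if for each $i$ either $x_i=\diamond$ or $x_i=y_i$. For $n\ge 1$, the window of $u$ at position $i\in\{1,\dots,N\}$ is $u_iu_{i+1}\cdots u_{i+n-1}$. An upcycle (universal partial cycle) for $A^n$ is a cyclic partial word $u=(u_1\cdots u_N)$ such that each word of $A^n$ is covered by the window at exactly one position $i\in\{1,\dots,N\}$. An upcycle is nontrivial if it contains at least one diamond and at least one letter. *)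

(* Defs.v *)
From mathcomp Require Import all_boot.

Set Implicit Arguments.
Unset Strict Implicit.
Unset Printing Implicit Defensive.

(* A partial word over [A] has symbols in [option A], with [None] the diamond.
   A cyclic partial word is given by a representative [u : seq (option A)],
   read with 0-based positions modulo [size u]; the notions below do not depend
   on the chosen rotation. *)

Definition covers (A : finType) (n : nat) (x y : n.-tuple (option A))
  : Prop :=
  forall i : 'I_n, tnth x i = None \/ tnth x i = tnth y i.

(* The length [n] may exceed [size u], in which case the window wraps around
   several times. The default [None] of [nth] is only reached when [u] is
   empty, and then there is no position. *)
Definition window (A : finType) (u : seq (option A)) (n i : nat)
  : n.-tuple (option A) :=
  [tuple nth None u ((i + j) %% size u) | j < n].

Definition word_partial (A : finType) (n : nat) (w : n.-tuple A)
  : n.-tuple (option A) :=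
  [tuple of map Some w].

Definition upcycle (A : finType) (n : nat) (u : seq (option A)) : Prop :=
  forall w : n.-tuple A,
    exists! i : 'I_(size u), covers (window u n i) (word_partial w).

Definition nontrivial (A : finType) (u : seq (option A)) : Prop :=
  None \in u /\ exists a : A, Some a \in u.

(* Main.v *)
Require Import Defs.
From mathcomp Require Import all_boot.

Set Implicit Arguments.
Unset Strict Implicit.
Unset Printing Implicit Defensive.

(** Consider a cycle made of 16 blocks of 7 bits, each followed by a diamond.
    Each of its 128 windows contains one diamond, hence covers two words of
    [{0,1}^8], the ends of an edge of the hypercube. The cycle is an upcycle
    exactly when these edges form a perfect matching of the hypercube. The
    blocks were found by a SAT search over the perfect matchings whose edges,
    seen as arcs from the length-7 prefix to the length-7 suffix of the window,
    form a balanced connected digraph; the cycle is an Eulerian circuit of it.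
    That each word is covered exactly once is verified by computation. *)

Fixpoint words (T : Type) (s : seq T) (n : nat) : seq (seq T) :=
  if n is n'.+1 then [seq x :: w | x <- s, w <- words s n'] else [:: [::]].

Lemma mem_words (T : eqType) (s w : seq T) :
  {subset w <= s} -> w \in words s (size w).
Proof.
elim: w => [|x w IHw] sub_ws //=.
apply/allpairsP; exists (x, w); split=> //=.
  by apply: sub_ws; rewrite mem_head.
by apply: IHw => y w_y; apply: sub_ws; rewrite inE w_y orbT.
Qed.

(** Plain sequences and natural positions replace tuples and ordinals, so that the test evaluates by
    [vm_compute]. *)
Definition covers_at (A : eqType) (u : seq (option A)) (w : seq A) (i : nat) :=
  all (fun j => let x := nth None u ((i + j) %% size u) in
         (x == None) || (x == onth w j))
      (iota 0 (size w)).

Lemma covers_atP (A : finType) n (u : seq (option A)) (w : n.-tuple A) i :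
  reflect (covers (window u n i) (word_partial w)) (covers_at u w i).
Proof.
rewrite /covers_at size_tuple.
have tnth_word (j : 'I_n) : tnth (word_partial w) j = onth w j.
  by rewrite onthE (tnth_nth None).
apply: (iffP allP) => [cov j | cov j].
  have := cov j; rewrite mem_iota ltn_ord => /(_ isT) /= /orP cov_j.
  by rewrite tnth_mktuple tnth_word; case: cov_j => /eqP; [left | right].
rewrite mem_iota /= add0n => lt_jn; have := cov (Ordinal lt_jn).
by rewrite tnth_mktuple tnth_word /= => -[->|->]; rewrite eqxx ?orbT.
Qed.

(** The alphabet is passed as an explicit list [s], to keep the enumeration of words computable. *)
Definition upcycleb (A : eqType) (s : seq A) (n : nat) (u : seq (option A)) :=
  all (fun w => count (covers_at u w) (iota 0 (size u)) == 1) (words s n).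

Lemma upcycle_upcycleb (A : finType) (s : seq A) n (u : seq (option A)) :
  (forall x, x \in s) -> upcycleb s n u -> upcycle n u.
Proof.
move=> s_all /allP up_u w.
have /up_u : (w : seq A) \in words s n.
  by rewrite -{2}(size_tuple w); apply: mem_words.
(* [r] lists the positions whose window covers [w]. Having length 1, it yields both existence and
   uniqueness. *)
rewrite -size_filter; set r := filter _ _.
have mem_r i : (i \in r) = covers_at u w i && (i < size u).
  by rewrite mem_filter mem_iota.
case: r mem_r => [|i [|? ?]] //= mem_r _.
have /andP[cov_i lt_iu] : covers_at u w i && (i < size u).
  by rewrite -mem_r mem_head.
exists (Ordinal lt_iu); split=> [|j /covers_atP cov_j]; first exact/covers_atP.
by apply/val_inj/eqP; rewrite eq_sym -mem_seq1 mem_r cov_j ltn_ord.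
Qed.

Definition blocks : seq (seq nat) :=
  [:: [:: 1; 1; 1; 0; 1; 0; 1]; [:: 1; 0; 0; 1; 1; 1; 1];
   [:: 0; 0; 0; 1; 0; 1; 1]; [:: 0; 1; 1; 0; 1; 1; 0];
   [:: 0; 1; 0; 0; 0; 0; 1]; [:: 0; 0; 1; 1; 1; 0; 0];
   [:: 0; 0; 0; 1; 0; 1; 0]; [:: 0; 1; 1; 0; 0; 0; 0];
   [:: 1; 1; 1; 0; 1; 0; 0]; [:: 1; 0; 0; 1; 0; 0; 1];
   [:: 1; 0; 1; 1; 1; 1; 1]; [:: 1; 1; 0; 0; 1; 0; 1];
   [:: 0; 1; 0; 0; 0; 0; 0]; [:: 0; 0; 1; 1; 0; 1; 0];
   [:: 1; 0; 1; 1; 1; 1; 0]; [:: 1; 1; 0; 0; 0; 1; 1]].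

(* [inord] would block the computation, since [insub] relies on the opaque [idP]. *)
Definition bit (k : nat) : 'I_2 := if k is 0 then ord0 else ord_max.

Definition cycle8 : seq (option 'I_2) :=
  flatten [seq rcons [seq Some (bit k) | k <- b] None | b <- blocks].

Theorem theorem3p1 :
  exists u : seq (option 'I_2), upcycle 8 u /\ nontrivial u.
Proof.
exists cycle8; split.
  apply: (@upcycle_upcycleb _ [:: ord0; ord_max]).
    by move=> [[|[|m]] lt_m2].
  by vm_compute.
split; first by vm_compute.
by exists ord0; vm_compute.
Qed.
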